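(* Let $\mathcal{SP}$ be the set of primes that divide some term of Sylvester's sequence. For any product $c=\prod p_i$ of (finitely many) distinct primes $p_i\in\mathcal{SP}$, there is some $n$ such that the cyclic group $\mathbb{Z}/c\mathbb{Z}$ is (up to isomorphism) the critical group of an arithmetical structure on $S_n$ and also the critical group of an arithmetical structure on $K_n$.
   Context: Sylvester's sequence $(s_m)_{m\geq 1}$ is defined by $s_1=2$ and $s_{m+1}=s_m^2-s_m+1$. An arithmetical structure on a finite, connected, loopless graph $G$ with vertex set $V(G)$ is a pair $(\mathbf{d},\mathbf{r})$, where $\mathbf{r}=(r_v)_{v\in V(G)}$ consists of positive integers with no common factor, $\mathbf{d}=(d_v)_{v\in V(G)}$ consists of nonnegative integers, and for every vertex $v$ we have $r_vd_v=\sum r_u$, the sum being over all $u$ adjacent to $v$ (with multiplicity for multigraphs). Its critical group $\mathcal{K}(G;\mathbf{d},\mathbf{r})$ is the torsion part of the cokernel (over $\mathbb{Z}$) of the matrix $L(G,\mathbf{d})=\operatorname{diag}(\mathbf{d})-A(G)$, where $A(G)$ is the adjacency matrix of $G$. The star graph $S_n$ has $n$ leaves $v_1,\dotsc,v_n$, each joined by one edge to a central vertex $v_0$ (and no other edges). $K_n$ denotes the (simple) complete graph on $n$ vertices. *)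

(* Defs.v *)
From HB Require Import structures.
From mathcomp Require Import all_boot all_order all_algebra.
From mathcomp Require Import boolp.

Set Implicit Arguments.
Unset Strict Implicit.
Unset Printing Implicit Defensive.

Import Order.TTheory GRing.Theory Num.Theory.
Local Open Scope ring_scope.

(* Indexed from 0: [sylvester k] is the term s_{k+1}, so that s_1 = 2.  The
   truncated subtraction is exact, as every term is positive. *)
Fixpoint sylvester (k : nat) : nat :=
  if k is k'.+1 then (sylvester k' ^ 2 - sylvester k' + 1)%N else 2.

Definition sylvester_prime (p : nat) : Prop :=
  prime p /\ exists k : nat, (p %| sylvester k)%N.

(* Finite connected loopless multigraphs, with vertices labelled by 'I_N;
   [mult u v] is the number of edges between u and v. *)
Record multigraph (N : nat) := Multigraph {
  mult :> 'I_N -> 'I_N -> nat;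
  mult_sym : forall u v, mult u v = mult v u;
  mult_loopless : forall v, mult v v = 0%N;
  mult_nonempty : (0 < N)%N;
  mult_connected : forall u v, connect (fun x y => 0 < mult x y)%N u v
}.

Definition star_mult (n : nat) (u v : 'I_n.+1) : nat :=
  (u == ord0) != (v == ord0).

Fact star_sym n (u v : 'I_n.+1) : star_mult u v = star_mult v u.
Proof. by rewrite /star_mult eq_sym. Qed.

Fact star_loopless n (v : 'I_n.+1) : star_mult v v = 0%N.
Proof. by rewrite /star_mult eqxx. Qed.

Fact star_connected n (u v : 'I_n.+1) :
  connect (fun x y => 0 < star_mult x y)%N u v.
Proof.
have to0 w : connect (fun x y => 0 < @star_mult n x y)%N w ord0.
  have [->|w0] := eqVneq w ord0; first exact: connect0.
  by apply: connect1; rewrite /star_mult eqxx (negPf w0).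
have from0 w : connect (fun x y => 0 < @star_mult n x y)%N ord0 w.
  have [->|w0] := eqVneq w ord0; first exact: connect0.
  by apply: connect1; rewrite /star_mult eqxx (negPf w0).
exact: connect_trans (to0 u) (from0 v).
Qed.

(* S_n, with n leaves: n + 1 vertices, the central one being [ord0]. *)
Definition star (n : nat) : multigraph n.+1 :=
  Multigraph (@star_sym n) (@star_loopless n) (ltn0Sn n) (@star_connected n).

Definition complete_mult (n : nat) (u v : 'I_n) : nat := u != v.

Fact complete_sym n (u v : 'I_n) : complete_mult u v = complete_mult v u.
Proof. by rewrite /complete_mult eq_sym. Qed.

Fact complete_loopless n (v : 'I_n) : complete_mult v v = 0%N.
Proof. by rewrite /complete_mult eqxx. Qed.

Fact complete_connected n (u v : 'I_n) :
  connect (fun x y => 0 < complete_mult x y)%N u v.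
Proof.
have [->|uv] := eqVneq u v; first exact: connect0.
by apply: connect1; rewrite /complete_mult uv.
Qed.

Definition complete (n : nat) (n_gt0 : (0 < n)%N) : multigraph n :=
  Multigraph (@complete_sym n) (@complete_loopless n) n_gt0
    (@complete_connected n).

Definition arithmetical_structure (N : nat) (G : multigraph N)
    (d r : 'I_N -> nat) : Prop :=
  [/\ forall v, (0 < r v)%N,
      \big[gcdn/0%N]_v r v = 1%N
    & forall v, (r v * d v = \sum_u G v u * r u)%N].

Definition adjacency (N : nat) (G : multigraph N) : 'M[int]_N :=
  \matrix_(u, v) (G u v)%:Z.

Definition laplacian (N : nat) (G : multigraph N) (d : 'I_N -> nat) :
  'M[int]_N := diag_mx (\row_v (d v)%:Z) - adjacency G.

Section Cokernel.
Variables (m n : nat) (L : 'M[int]_(m, n)).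

Definition in_image : {pred 'cV[int]_m} :=
  fun y => `[< exists x : 'cV[int]_n, y = L *m x >].

Fact in_image_zmod_closed : zmod_closed in_image.
Proof.
split=> [|_ _ /asboolP[x ->] /asboolP[y ->]]; apply/asboolP.
  by exists 0; rewrite mulmx0.
by exists (x - y); rewrite mulmxBr.
Qed.

HB.instance Definition _ :=
  GRing.isZmodClosed.Build 'cV[int]_m in_image in_image_zmod_closed.

Definition cokernel : zmodType := @Quotient.quot 'cV[int]_m in_image.

End Cokernel.

Section Torsion.
Variable A : zmodType.

Definition is_torsion : {pred A} :=
  fun x => `[< exists2 k : nat, (0 < k)%N & x *+ k = 0 >].

Fact is_torsion_zmod_closed : zmod_closed is_torsion.
Proof.
split=> [|x y /asboolP[k k0 xk] /asboolP[l l0 yl]]; apply/asboolP.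
  by exists 1%N.
exists (k * l)%N; first by rewrite muln_gt0 k0.
by rewrite mulrnBl mulrnA xk mul0rn mulnC mulrnA yl mul0rn subr0.
Qed.

HB.instance Definition _ :=
  GRing.isZmodClosed.Build A is_torsion is_torsion_zmod_closed.

Record torsion := Torsion { torsion_val :> A; _ : torsion_val \in is_torsion }.

HB.instance Definition _ := [isSub for torsion_val].
HB.instance Definition _ := [Choice of torsion by <:].
HB.instance Definition _ := [SubChoice_isSubZmodule of torsion by <:].

End Torsion.

(* L(G, d), hence the group, depends on the structure (d, r) only through d. *)
Definition critical_group (N : nat) (G : multigraph N) (d r : 'I_N -> nat) :
  zmodType := torsion (cokernel (laplacian G d)).

(* The quotient of int by c int.  The library's ordinal-based 'Z_c is not
   Z/cZ when c = 1. *)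
Definition Zmod (c : nat) : zmodType := @Quotient.quot int (dvdz c%:Z : {pred int}).

Definition zmod_isomorphic (A B : zmodType) : Prop :=
  exists f : {additive A -> B}, bijective f.

Definition is_critical_group_on (N : nat) (G : multigraph N) (A : zmodType) :
  Prop :=
  exists d r : 'I_N -> nat,
    arithmetical_structure G d r /\ zmod_isomorphic A (critical_group G d r).

(* Main.v *)
(** Sylvester's sequence satisfies s_{m+1} = P + 1 with P = s_1 ... s_m, whence
    1/s_1 + ... + 1/s_m + 1/P = 1, and c divides P once m is large.  Writing
    P = c q, we split 1/P = 1/(c (q+1)) + 1/(P (q+1)); this gives
    1 = sum of n = m + 2 unit fractions 1/E_v, hence an arithmetical structure
    on K_n (d_v = E_v - 1) and one on S_n (d_v = E_v on leaves, d = 1 at the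
    center).  Both cokernels are generated by elements e_v subject to
    E_v e_v = sum_u e_u.  The relations at the s_i amount to e_i = (P/s_i) g for
    g = x + y, where x and y are the generators at the last two vertices, and
    what remains is the single relation c (x - q y) = 0: the cokernel is
    Z + Z/c. *)

Require Import Defs.
From HB Require Import structures.
From mathcomp Require Import all_boot all_order all_algebra.
From mathcomp Require Import boolp zify ring.

Set Implicit Arguments.
Unset Strict Implicit.
Unset Printing Implicit Defensive.

Import Order.TTheory GRing.Theory Num.Theory.
Local Open Scope ring_scope.

(** * Cokernels whose torsion is cyclic *)

Lemma quot_eqP (V : zmodType) (I : zmodClosed V) (x y : V) :
  reflect (x = y %[mod (Quotient.quot I)])%qT (x - y \in I).
Proof. by rewrite Quotient.idealrBE; apply: eqP. Qed.

Lemma quot_eq0P (V : zmodType) (I : zmodClosed V) (x : V) :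
  reflect (\pi_(Quotient.quot I) x = 0)%qT (x \in I).
Proof.
by rewrite -[x in x \in I]subr0; apply: (iffP (quot_eqP _ _ _)); rewrite raddf0.
Qed.

Lemma Zmod_eqP (c : nat) (x y : int) :
  reflect (x = y %[mod (Zmod c)])%qT (c%:Z %| x - y)%Z.
Proof. exact: quot_eqP. Qed.

(** The pair (h, k mod c) embeds the cokernel in Z + Z/c. Torsion classes have h = 0, so k mod c
    identifies them with Z/c, and the class of [w] is a generator. *)
Lemma torsion_cokernel_cyclic (m n c : nat) (L : 'M[int]_(m, n))
    (h k : {additive 'cV[int]_m -> int}) (w : 'cV[int]_m) :
    (0 < c)%N -> h w = 0 -> k w = 1 ->
    (forall v, v \in in_image L <-> h v = 0 /\ (c%:Z %| k v)%Z) ->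
  zmod_isomorphic (Zmod c) (torsion (cokernel L)).
Proof.
move=> c_gt0 hw kw imL.
pose pi := (\pi_(cokernel L) : 'cV[int]_m -> cokernel L)%qT.
pose piZ := (\pi_(Zmod c) : int -> Zmod c)%qT.
have w_tors z : pi (w *~ z) \in @is_torsion (cokernel L).
  apply/asboolP; exists c => //; rewrite -raddfMn.
  apply/quot_eq0P/imL; rewrite 2!raddfMn 2!raddfMz /= hw kw mul0rz mul0rn.
  by split=> //; rewrite intz -mulr_natr natz dvdz_mull.
pose f (z : Zmod c) : torsion (cokernel L) := Torsion (w_tors (repr z)).
pose g (t : torsion (cokernel L)) : Zmod c := piZ (k (repr (torsion_val t))).
have f_pi z t : pi (w *~ z) = torsion_val t -> f (piZ z) = t.
  move=> zt; apply: val_inj; rewrite /= -zt; apply/quot_eqP.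
  rewrite -mulrzBr; apply/imL; rewrite 2!raddfMz /= hw kw mul0rz; split=> //.
  by rewrite intz; apply/Zmod_eqP; rewrite reprK.
have f_add : zmod_morphism f.
  move=> x y; rewrite -[x in x - y]reprK -[y in _ - y]reprK -raddfB.
  by apply: f_pi; rewrite mulrzBr; apply: raddfB.
pose fM := GRing.isZmodMorphism.Build _ _ f f_add.
pose F : {additive Zmod c -> torsion (cokernel L)} :=
  HB.pack f fM.
exists F; exists g => [z|t] /=.
  rewrite /g -[RHS]reprK; apply/Zmod_eqP.
  rewrite /f /= -[repr z in X in _ - X]intz -[1]kw -raddfMz -raddfB.
  suff /imL[_ ->] : repr (pi (w *~ repr z)) - w *~ repr z \in in_image L by [].
  by apply/quot_eqP; rewrite reprK.
apply: f_pi; rewrite -[RHS]reprK; set v := repr _.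
apply/quot_eqP/imL; rewrite !raddfB /= !raddfMz /= hw kw intz subrr dvdz0.
split=> //; rewrite mul0rz sub0r.
(* It remains to see that h(v) = 0: a positive multiple j v lies in the image, so j h(v) = 0 in
   Z. *)
have /asboolP[j j_gt0] := valP t; rewrite -[val t]reprK -raddfMn.
move=> /quot_eq0P/imL[+ _]; rewrite raddfMn /= => /eqP.
by rewrite mulrn_eq0 gtn_eqF //= => /eqP->; rewrite oppr0.
Qed.

(** * Functionals and relations on the cokernel of a Laplacian *)

Definition covector (N : nat) (f : 'I_N -> nat) (v : 'cV[int]_N) : int :=
  ((\row_i (f i)%:Z) *m v) 0 0.

Fact covector_is_zmod_morphism N (f : 'I_N -> nat) :
  zmod_morphism (covector f).
Proof. by move=> u v; rewrite /covector mulmxBr !mxE. Qed.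

HB.instance Definition _ N (f : 'I_N -> nat) :=
  GRing.isZmodMorphism.Build _ _ (covector f) (covector_is_zmod_morphism f).

Lemma covector_delta N (f : 'I_N -> nat) i : covector f (delta_mx i 0) = f i.
Proof. by rewrite /covector -colE !mxE. Qed.

(** The coefficient of x_v measures how far [f] is from satisfying the structure equation at v; it
    vanishes when [f] is the r of a structure. *)
Lemma covector_laplacian N (G : multigraph N) d (f : 'I_N -> nat)
    (x : 'cV[int]_N) :
  covector f (laplacian G d *m x) =
    \sum_v ((f v * d v)%N%:Z - (\sum_u G v u * f u)%N%:Z) * x v 0.
Proof.
rewrite /covector mulmxA mxE; apply: eq_bigr => v _; congr (_ * _).
rewrite mulmxBr mul_mx_diag !mxE PoszM; congr (_ - _).
rewrite -natz raddf_sum; apply: eq_bigr => u _ /=.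
by rewrite natz !mxE PoszM mulrC mult_sym.
Qed.

Lemma cokernel_laplacian_rel N (G : multigraph N) d v
    (e := fun u => (\pi_(cokernel (laplacian G d)) (delta_mx u 0))%qT) :
  e v *+ d v = \sum_u e u *+ G v u.
Proof.
apply/eqP; rewrite -subr_eq0 /e -raddfMn.
under eq_bigr do rewrite -raddfMn.
rewrite -raddf_sum -raddfB; apply/eqP/quot_eq0P/asboolP.
(* The relation at v is column v of the Laplacian. *)
exists (delta_mx v 0); apply/matrixP => i j; rewrite !ord1 -colE !mxE summxE.
rewrite !mulmxnE !mxE eqxx andbT.
have -> : ((i == v)%:R : int) *+ d v = (d i)%:Z *+ (i == v).
  by case: eqP => [->|_]; rewrite ?mul0rn ?natz.
congr (_ - _); rewrite (bigD1 i) //= big1 => [|u ui].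
  by rewrite mulmxnE !mxE !eqxx addr0 mult_sym; apply: natz.
by rewrite mulmxnE !mxE eq_sym (negPf ui) mul0rn.
Qed.

Lemma col_sum_delta N (v : 'cV[int]_N) :
  v = \sum_i delta_mx i 0 *~ v i 0.
Proof.
apply/matrixP => i j; rewrite !ord1 summxE (bigD1 i) //= big1 => [|u ui].
  by rewrite -scaler_int !mxE !eqxx mulr1 addr0 intz.
by rewrite -scaler_int !mxE eq_sym (negPf ui) mulr0.
Qed.

(* The hypothesis on all A says that, in the abelian group presented by the
   Laplacian, a and b generate and c (a - q b) = 0; the functional r splits off
   the free part, and k then detects the torsion modulo c. *)
Lemma critical_group_cyclic N (G : multigraph N) (d k l : 'I_N -> nat)
    (a b : 'I_N) (q c : nat) (r := fun v => (q * k v + l v)%N) :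
    (0 < c)%N -> arithmetical_structure G d r ->
    k a = 1%N -> l a = 0%N -> k b = 0%N -> l b = 1%N ->
    (forall v, k v * d v = \sum_u G v u * k u %[mod c])%N ->
    (forall (A : zmodType) (e : 'I_N -> A),
       (forall v, e v *+ d v = \sum_u e u *+ G v u) ->
       e a *+ c = e b *+ (c * q) /\
       forall v, e v = e a *+ k v + e b *+ l v) ->
  is_critical_group_on G (Zmod c).
Proof.
move=> c_gt0 rG ka la kb lb kG gen.
exists d, r; split=> //.
have ra : r a = q by rewrite /r ka la; lia.
have rb : r b = 1%N by rewrite /r kb lb; lia.
pose w : 'cV[int]_N := delta_mx a 0 - delta_mx b 0 *+ q.
apply: (@torsion_cokernel_cyclic _ _ _ _ (covector r) (covector k) w) => //.
- by rewrite raddfB raddfMn /= !covector_delta ra rb natz subrr.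
- by rewrite raddfB raddfMn /= !covector_delta ka kb mul0rn.
move=> v; split=> [/asboolP[x ->]|[rv /dvdzP[t kv]]].
  split; rewrite /= covector_laplacian.
    by case: rG => _ _ rG; apply: big1 => u _; rewrite rG subrr mul0r.
  apply: rpred_sum => u _; apply: dvdz_mulr.
  by rewrite -eqz_mod_dvd !modz_nat kG.
pose e u := (\pi_(cokernel (laplacian G d)) (delta_mx u 0))%qT.
have [ec ekl] := gen _ e (cokernel_laplacian_rel G d).
(* Since r = q k + l, r(v) = 0 makes the class of v equal to k(v) (a - q b), which vanishes once c
   divides k(v). *)
have lv : covector l v = - (q%:Z * covector k v).
  apply/eqP; rewrite -addr_eq0 -rv /= /covector !mxE mulr_sumr -big_split /=.
  by apply/eqP/eq_bigr => i _; rewrite !mxE PoszD PoszM; ring.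
apply/quot_eq0P; suff -> : (\pi_(cokernel (laplacian G d)) v)%qT =
    e a *~ covector k v + e b *~ covector l v.
  rewrite lv kv mulrNz [(t * _)%R]mulrC mulrA !mulrzA -!pmulrn ec mulrnA.
  by rewrite mulrnAC subrr.
rewrite {1}[v]col_sum_delta raddf_sum /covector !mxE 2!mulrz_sumr -big_split /=.
apply: eq_bigr => i _; rewrite raddfMz /= -/(e i) ekl mulrzDl !mxE.
by rewrite !mulrzA -!pmulrn.
Qed.

(** * Reduction of both graphs to the relations E_v e_v = sum_u e_u *)

Lemma biggcdn_eq1 (I : finType) (r : I -> nat) (b : I) :
  r b = 1%N -> \big[gcdn/0%N]_v r v = 1%N.
Proof.
by move=> rb; apply/eqP; rewrite -dvdn1 -rb; apply: (biggcdn_inf b).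
Qed.

(** On K_n, adding the term at v to both sides of its equation completes the sum over neighbours to
    a sum over all vertices, and turns d_v into E_v = d_v + 1. *)
Lemma complete_critical_group n (n_gt0 : (0 < n)%N) (E k l : 'I_n -> nat)
    (a b : 'I_n) (q c : nat) (r := fun v => (q * k v + l v)%N) :
    (0 < c)%N -> (forall v, 0 < r v)%N ->
    (forall v, r v * E v = \sum_u r u)%N ->
    k a = 1%N -> l a = 0%N -> k b = 0%N -> l b = 1%N ->
    (forall v, k v * E v = \sum_u k u %[mod c])%N ->
    (forall (A : zmodType) (e : 'I_n -> A),
       (forall v, e v *+ E v = \sum_u e u) ->
       e a *+ c = e b *+ (c * q) /\
       forall v, e v = e a *+ k v + e b *+ l v) ->
  is_critical_group_on (complete n_gt0) (Zmod c).
Proof.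
move=> c_gt0 r_gt0 rE ka la kb lb kE gen.
have sumC (f : 'I_n -> nat) v :
    (\sum_u f u = f v + \sum_u complete n_gt0 v u * f u)%N.
  rewrite (bigD1 v) //= [in RHS](bigD1 v) //= complete_loopless mul0n add0n.
  congr addn; apply: eq_bigr => u uv.
  by rewrite /complete_mult eq_sym uv mul1n.
(* This makes [(E v).-1] an exact predecessor. *)
have E_gt0 v : (0 < E v)%N.
  have := rE v; rewrite (sumC r v); have := r_gt0 v.
  case: (E v) => //; rewrite muln0 => + /esym/eqP.
  by rewrite addn_eq0 => /gtn_eqF->.
apply: (critical_group_cyclic (d := fun v => (E v).-1) (q := q)
  c_gt0 _ ka la kb lb) => [|v|A e eE].
- split=> // [|v]; first by apply: (@biggcdn_eq1 _ _ b); rewrite kb lb; lia.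
  by apply: (@addnI (r v)); rewrite -sumC -(rE v) -mulnS prednK.
- by apply/eqP; rewrite -(eqn_modDl (k v)) -sumC -mulnS prednK // kE.
apply: gen => v; rewrite -(prednK (E_gt0 v)) mulrS eE.
rewrite (bigD1 v) //= complete_loopless mulr0n add0r [RHS](bigD1 v) //=.
congr (_ + _); apply: eq_bigr => u uv.
by rewrite /complete_mult eq_sym uv.
Qed.

(** With d = 1 at the center, the central generator is the sum of the leaf generators; eliminating
    it from the leaf relations leaves E_v e_v = sum_u e_u. *)
Lemma star_critical_group n (E k l : 'I_n -> nat)
    (a b : 'I_n) (q c : nat) (r := fun v => (q * k v + l v)%N) :
    (0 < c)%N -> (forall v, 0 < r v)%N ->
    (forall v, r v * E v = \sum_u r u)%N ->
    k a = 1%N -> l a = 0%N -> k b = 0%N -> l b = 1%N ->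
    (forall v, k v * E v = \sum_u k u %[mod c])%N ->
    (forall (A : zmodType) (e : 'I_n -> A),
       (forall v, e v *+ E v = \sum_u e u) ->
       e a *+ c = e b *+ (c * q) /\
       forall v, e v = e a *+ k v + e b *+ l v) ->
  is_critical_group_on (star n) (Zmod c).
Proof.
move=> c_gt0 r_gt0 rE ka la kb lb kE gen.
pose ext x (f : 'I_n -> nat) (v : 'I_n.+1) :=
  if unlift ord0 v is Some i then f i else x.
have ext0 x f : ext x f ord0 = x by rewrite /ext unlift_none.
have extS x f i : ext x f (lift ord0 i) = f i by rewrite /ext liftK.
have star0 : star n ord0 ord0 = 0%N by [].
have star0S i : star n ord0 (lift ord0 i) = 1%N by [].
have starS0 i : star n (lift ord0 i) ord0 = 1%N by [].
have sum0 (f : 'I_n.+1 -> nat) :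
    (\sum_u star n ord0 u * f u = \sum_i f (lift ord0 i))%N.
  rewrite big_ord_recl star0 mul0n add0n.
  by apply: eq_bigr => i _; rewrite star0S mul1n.
have sumS (f : 'I_n.+1 -> nat) i :
    (\sum_u star n (lift ord0 i) u * f u = f ord0)%N.
  by rewrite big_ord_recl starS0 mul1n big1 ?addn0.
(* The central relation forces these values at the center. *)
pose K := ext (\sum_u k u)%N k; pose L := ext (\sum_u l u)%N l.
have sum_r : (q * (\sum_u k u) + \sum_u l u = \sum_u r u)%N.
  by rewrite big_distrr -big_split.
apply: (critical_group_cyclic (d := ext 1%N E) (k := K) (l := L) (q := q)
  (a := lift ord0 a) (b := lift ord0 b) c_gt0); rewrite /K /L ?extS //.
- split=> [v||v].
  + case: (unliftP ord0 v) => [i|] ->; first by rewrite !extS r_gt0.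
    rewrite !ext0 sum_r (bigD1 a) //=; apply: ltn_addr; exact: r_gt0.
  + by apply: (@biggcdn_eq1 _ _ (lift ord0 b)); rewrite !extS kb lb; lia.
  case: (unliftP ord0 v) => [i|] ->.
    by rewrite sumS !ext0 !extS sum_r rE.
  rewrite sum0 !ext0 muln1 sum_r.
  by apply: eq_bigr => i _; rewrite !extS.
- move=> v; case: (unliftP ord0 v) => [i|] ->.
    by rewrite sumS ext0 !extS kE.
  by rewrite sum0 !ext0 muln1; congr modn; apply: eq_bigr => i _; rewrite extS.
move=> A e eE.
have e0 : e ord0 = \sum_i e (lift ord0 i).
  have := eE ord0; rewrite ext0 mulr1n big_ord_recl star0 mulr0n add0r.
  by under eq_bigr do rewrite star0S.
have eS i : e (lift ord0 i) *+ E i = e ord0.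
  by have := eE (lift ord0 i); rewrite extS big_ord_recl starS0 big1 ?addr0.
have [ac ekl] := gen A (fun i => e (lift ord0 i)) (fun i => etrans (eS i) e0).
split=> // v; case: (unliftP ord0 v) => [i|] ->; first by rewrite !extS.
rewrite !ext0 e0 -!sumrMnr -big_split /=.
by apply: eq_bigr => i _; rewrite -ekl.
Qed.

(** * Arithmetic of Sylvester's sequence *)

Definition sylvester_prod (m : nat) : nat := \prod_(i < m) sylvester i.

Lemma sylvester_prodS m :
  sylvester_prod m.+1 = (sylvester_prod m * sylvester m)%N.
Proof. exact: big_ord_recr. Qed.

Lemma sylvesterE m : sylvester m = (sylvester_prod m).+1.
Proof.
elim: m => [|m IHm]; first by rewrite /sylvester_prod big_ord0.
by rewrite sylvester_prodS /= IHm; nia.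
Qed.

Lemma sylvester_gt0 m : (0 < sylvester m)%N.
Proof. by rewrite sylvesterE. Qed.

Lemma sylvester_prod_gt0 m : (0 < sylvester_prod m)%N.
Proof. by apply: prodn_gt0 => i; apply: sylvester_gt0. Qed.

Lemma dvdn_sylvester_prod i m :
  (i < m)%N -> (sylvester i %| sylvester_prod m)%N.
Proof.
by move=> im; rewrite /sylvester_prod (bigD1 (Ordinal im)) //= dvdn_mulr.
Qed.

Lemma sylvester_prod_dvd m n :
  (m <= n)%N -> (sylvester_prod m %| sylvester_prod n)%N.
Proof.
elim: n => [|n IHn]; first by rewrite leqn0 => /eqP->.
rewrite leq_eqVlt => /predU1P[->//|/IHn]; rewrite sylvester_prodS.
exact: dvdn_mulr.
Qed.

Lemma prod_sylvester_primes_dvd (ps : seq nat) :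
    uniq ps -> (forall p, p \in ps -> sylvester_prime p) ->
  exists m, (\prod_(p <- ps) p %| sylvester_prod m)%N.
Proof.
elim: ps => [|p ps IHps] /=; first by exists 0%N; rewrite big_nil.
move=> /andP[p_ps ps_uniq] ps_SP.
have [p_prime [i p_i]] := ps_SP p (mem_head _ _).
have [q q_ps|m ps_m] := IHps ps_uniq.
  by apply: ps_SP; rewrite inE q_ps orbT.
(* [i.+1], because [sylvester_prod i] stops just before the factor [sylvester i]. *)
exists (maxn m i.+1); rewrite big_cons Gauss_dvd; last first.
  rewrite coprime_sym big_seq; apply: (big_ind (coprime^~ p)) => [|x y|q q_ps].
  - exact: coprime1n.
  - by rewrite coprimeMl => -> ->.
  have [q_prime _] : sylvester_prime q by apply: ps_SP; rewrite inE q_ps orbT.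
  rewrite prime_coprime // dvdn_prime2 //.
  by apply: contraNneq p_ps => <-.
rewrite (dvdn_trans p_i) ?dvdn_sylvester_prod ?leq_maxr //=.
by rewrite (dvdn_trans ps_m) ?sylvester_prod_dvd ?leq_maxl.
Qed.

Definition sylvester_cofactor (m i : nat) : nat :=
  sylvester_prod m %/ sylvester i.

Lemma sylvester_cofactorK m i : (i < m)%N ->
  (sylvester_cofactor m i * sylvester i)%N = sylvester_prod m.
Proof. by move=> im; rewrite divnK ?dvdn_sylvester_prod. Qed.

Lemma sylvester_cofactor_gt0 m i : (i < m)%N -> (0 < sylvester_cofactor m i)%N.
Proof.
move=> im; have := sylvester_prod_gt0 m.
by rewrite -(sylvester_cofactorK im) muln_gt0 => /andP[].
Qed.

Lemma sylvester_cofactorS m i : (i < m)%N ->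
  sylvester_cofactor m.+1 i = (sylvester_cofactor m i * sylvester m)%N.
Proof.
move=> im.
by rewrite /sylvester_cofactor sylvester_prodS divn_mulAC ?dvdn_sylvester_prod.
Qed.

Lemma sylvester_cofactor_last m :
  sylvester_cofactor m.+1 m = sylvester_prod m.
Proof.
by rewrite /sylvester_cofactor sylvester_prodS mulnK ?sylvester_gt0.
Qed.

(** This is 1/s_1 + ... + 1/s_m + 1/P = 1 multiplied by P. *)
Lemma sum_sylvester_cofactor m :
  (\sum_(i < m) sylvester_cofactor m i).+1 = sylvester_prod m.
Proof.
elim: m => [|m IHm]; first by rewrite /sylvester_prod !big_ord0.
rewrite big_ord_recr /= sylvester_cofactor_last.
under eq_bigr do rewrite sylvester_cofactorS //.
rewrite -big_distrl sylvester_prodS /= sylvesterE -IHm.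
by rewrite mulSn [RHS]addnC !addnS.
Qed.

(* As s_{m+1} = P + 1, replacing g by g' = g - e_m gives e_m = P g' and
   g = s_{m+1} g'. *)
Lemma sylvester_relations (A : zmodType) (m : nat) (e : nat -> A) (s : A)
    (g := s - \sum_(i < m) e i) :
    (forall i, (i < m)%N -> e i *+ sylvester i = s) ->
  g *+ sylvester_prod m = s /\
  forall i, (i < m)%N -> e i = g *+ sylvester_cofactor m i.
Proof.
elim: m @g => [|m IHm] g es.
  by rewrite /g /sylvester_prod !big_ord0 subr0.
have [i im|gs eg] := IHm; first by apply: es; apply: ltnW.
set g0 := s - _ in gs eg.
have gE : g = g0 - e m by rewrite /g big_ord_recr opprD addrA.
have em : e m = g *+ sylvester_prod m.
  by rewrite gE mulrnBl gs -(es m) // sylvesterE mulrS addrK.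
have g0E : g0 = g *+ sylvester m by rewrite sylvesterE mulrS -em gE subrK.
split=> [|i]; first by rewrite sylvester_prodS mulnC mulrnA -g0E.
rewrite ltnS leq_eqVlt => /predU1P[->|im].
  by rewrite sylvester_cofactor_last.
by rewrite sylvester_cofactorS // mulnC mulrnA -g0E eg.
Qed.

(** * Families on m + 2 vertices, and the final construction *)

(** The first m vertices carry the Sylvester terms; the last two carry the parts into which 1/P is
    split. *)
Definition extend2 (T : Type) (m : nat) (f : nat -> T) (x y : T)
    (i : 'I_m.+2) : T :=
  if (i < m)%N then f i else if i == m :> nat then x else y.

Lemma extend2_inord T m (f : nat -> T) x y i :
  (i < m)%N -> extend2 f x y (inord i : 'I_m.+2) = f i.
Proof. by move=> im; rewrite /extend2 inordK ?im // 2?ltnS ltnW // ltnW. Qed.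

Lemma extend2_inord_max T m (f : nat -> T) x y :
  extend2 f x y (inord m : 'I_m.+2) = x.
Proof. by rewrite /extend2 inordK // ltnn eqxx. Qed.

Lemma extend2_max T m (f : nat -> T) x y :
  extend2 f x y (ord_max : 'I_m.+2) = y.
Proof. by rewrite /extend2 /= ltnNge leqnSn /= (gtn_eqF (ltnSn m)). Qed.

Lemma forall_ord2 m (P : 'I_m.+2 -> Prop) :
    (forall i, (i < m)%N -> P (inord i)) -> P (inord m) -> P ord_max ->
  forall v, P v.
Proof.
move=> Pm Px Py v; have := ltn_ord v.
rewrite ltnS leq_eqVlt => /predU1P[vm|].
  by have -> : v = ord_max by apply: val_inj.
rewrite ltnS leq_eqVlt -[v in P v]inord_val => /predU1P[->//|].
exact: Pm.
Qed.

Lemma big_ord2 (R : Type) (idx : R) (op : Monoid.law idx) m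
    (F : 'I_m.+2 -> R) :
  \big[op/idx]_i F i =
    op (op (\big[op/idx]_(i < m) F (inord i)) (F (inord m))) (F ord_max).
Proof.
rewrite !big_ord_recr; congr (op (op _ _) _).
  apply: eq_bigr => i _; congr F; apply: val_inj; rewrite /= inordK //.
  by have := ltn_ord i; lia.
by congr F; apply: val_inj; rewrite /= inordK.
Qed.

Theorem proposition15 (ps : seq nat) (ps_uniq : uniq ps)
    (ps_SP : forall p : nat, p \in ps -> sylvester_prime p) :
  exists (n : nat) (n_gt0 : (0 < n)%N),
    is_critical_group_on (star n) (Zmod (\prod_(p <- ps) p)%N) /\
    is_critical_group_on (complete n_gt0) (Zmod (\prod_(p <- ps) p)%N).
Proof.
have [m] := prod_sylvester_primes_dvd ps_uniq ps_SP.
set c := (\prod_(p <- ps) p)%N => /dvdnP[q Pqc].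
have := sylvester_prod_gt0 m; rewrite Pqc muln_gt0 => /andP[q_gt0 c_gt0].
pose E := @extend2 nat m sylvester (c * q.+1)%N (sylvester_prod m * q.+1)%N.
(* [k] and [l] are the coordinates of e_v in terms of x and y; they agree at the Sylvester vertices,
   where e_i = (P/s_i)(x + y). *)
pose k := @extend2 nat m (sylvester_cofactor m) 1%N 0%N.
pose l := @extend2 nat m (sylvester_cofactor m) 0%N 1%N.
pose ext2 := (extend2_inord_max, extend2_max, extend2_inord).
have sum2 (f : nat -> nat) x y :
    (\sum_(i < m.+2) extend2 f x y i = \sum_(i < m) f i + x + y)%N.
  rewrite big_ord2 /= !ext2; congr (_ + _ + _)%N.
  by apply: eq_bigr => i _; rewrite extend2_inord.
have sum_cof := sum_sylvester_cofactor m.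
have sum_k : (\sum_v k v = sylvester_prod m)%N by rewrite sum2; lia.
have sum_l : (\sum_v l v = sylvester_prod m)%N by rewrite sum2; lia.
have r_gt0 v : (0 < q * k v + l v)%N.
  elim/forall_ord2: v => [i im||]; rewrite /k /l !ext2 //.
  - by rewrite addn_gt0 sylvester_cofactor_gt0 ?orbT.
  - by rewrite muln1 addn0.
  by rewrite addn1.
(* Both sides equal P (q + 1): r is (q + 1) P/s_i at the Sylvester vertices, then q and 1. *)
have rE v : ((q * k v + l v) * E v = \sum_u (q * k u + l u))%N.
  rewrite big_split -big_distrr /= sum_k sum_l.
  elim/forall_ord2: v => [i im||]; rewrite /k /l /E !ext2 //.
  - by rewrite mulnDl -mulnA sylvester_cofactorK.
  - by rewrite Pqc; lia.
  by lia.
(* Both sides are P at the Sylvester vertices; at the last two, both are multiples of c. *)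
have kE v : k v * E v = \sum_u k u %[mod c].
  rewrite sum_k.
  elim/forall_ord2: v => [i im||]; rewrite /k /E !ext2 //.
  - by rewrite sylvester_cofactorK.
  - by rewrite mul1n Pqc modnMr modnMl.
  by rewrite Pqc mul0n modnMl mod0n.
have gen (A : zmodType) (e : 'I_m.+2 -> A) :
    (forall v, e v *+ E v = \sum_u e u) ->
    e (inord m) *+ c = e ord_max *+ (c * q) /\
    forall v, e v = e (inord m) *+ k v + e ord_max *+ l v.
  move=> eE; set s := \sum_u e u in eE.
  have [i im|gs eg] := @sylvester_relations A m (fun i => e (inord i)) s.
    by rewrite -(eE (inord i)) /E !ext2.
  have g_xy : s - \sum_(i < m) e (inord i) = e (inord m) + e ord_max.
    by rewrite /s big_ord2 /= -addrA addrAC subrr add0r.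
  rewrite g_xy in gs eg; split.
    (* The relation at x reads c (q + 1) x = s = c q (x + y); cancelling c q x leaves c x = c q
       y. *)
    have := eE (inord m); rewrite /E !ext2 -gs Pqc mulnS mulrnDr mulrnDl.
    by rewrite mulnC addrC; apply: addrI.
  elim/forall_ord2 => [i im||]; rewrite /k /l !ext2 //.
  - by rewrite eg // mulrnDl.
  - by rewrite mulr0n addr0.
  by rewrite mulr0n add0r.
exists m.+2, (ltn0Sn m.+1); split.
  by apply: (@star_critical_group _ E k l (inord m) ord_max q);
    rewrite /k /l ?ext2.
by apply: (@complete_critical_group _ _ E k l (inord m) ord_max q);
  rewrite /k /l ?ext2.
Qed.
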